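(* Let $\mathbb{F}$ be a field of characteristic $p$ ($p=0$ or $p$ prime). Let $f=g/h\in\mathbb{F}(X)$ with $g,h\in\mathbb{F}[X]$ coprime and $d=\deg f=\max\{\deg g,\deg h\}\ge 2$. Assume that $f$ is not a monomial, is not a binomial of the form $aX^{p^{\ell}}+b$ (with $a\ne0$, $b\in\mathbb{F}$, $\ell\ge 0$ an integer; when $p=0$ this exclusion is vacuous since $d\ge 2$), and is not linearly conjugate to $1/X^d$. For $n\ge1$ put $$\Psi(n)=\min_{\substack{k_1,\dots,k_n\in\mathbb{Z}\\ k_n\ne0}}\deg\Big(\big(f^{(1)}\big)^{k_1}\cdots\big(f^{(n)}\big)^{k_n}\Big).$$ Let $e$ be the smallest positive integer $k$ such that $0$ is a zero of $f^{(k)}$ (with $e=\infty$ if there is no such $k$). Then: (i) If $f\in\mathbb{F}[X]$, then $\Psi(n)\ge d^n$ if $n\le e$, and $\Psi(n)\ge d^{n-e}$ otherwise. (ii) If $\deg g>\deg h\ge1$ or $1\le\deg g<\deg h$, then $\Psi(n)\ge d^{n-1}$ for all $n\ge1$. (iii) Suppose that either $\deg g=0<\deg h$ or $\deg g=\deg h$, and suppose moreover that $f$ is separable or $f$ is not of the form $L(X^{p^{\ell}})$ with $L\in\mathbb{F}(X)$ of degree $1$ and $\ell\ge1$. Then there exists an integer $j\ge0$ such that for all $n\ge1$, $\Psi(n)\ge d^n$ if $n\le j$ and $\Psi(n)\ge d^{n-j}$ otherwise.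
   Context: A nonconstant rational function $f\in\mathbb{F}(X)$ is written in lowest terms $f=g/h$ with $\gcd(g,h)=1$; its degree is $\deg f=\max\{\deg g,\deg h\}$. Zeros (resp. poles) of $f$ are the roots in an algebraic closure $\overline{\mathbb{F}}$ of the numerator $g$ (resp. denominator $h$). Iterates: $f^{(0)}(X)=X$, $f^{(k)}=f\circ f^{(k-1)}$ for $k\ge1$. Two rational functions $\phi,\phi'\in\mathbb{F}(X)$ are linearly conjugate if $\phi'=\psi^{-1}\circ\phi\circ\psi$ for some $\psi\in\mathbb{F}(X)$ of degree $1$. $f$ is separable if its derivative is nonzero (i.e. $f\notin\mathbb{F}(X^p)$ when $p>0$; every nonconstant $f$ is separable when $p=0$).
   Formalization: ''Not a monomial'' is taken to exclude all cX^m with c≠0 and m any integer, also negative; otherwise (iii) fails, e.g. f=2/X^2 over the rationals, not linearly conjugate to 1/X^2, has (f^(1))^2 f^(2)=2 constant, so Ψ(2)=0. *)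

(* Defs.v *)
From HB Require Import structures.
From mathcomp Require Import all_boot all_order all_algebra.
Set Implicit Arguments. Unset Strict Implicit. Unset Printing Implicit Defensive.
Import Order.TTheory GRing.Theory Num.Theory.
Local Open Scope ring_scope.

Section RatFun.
Variable F : fieldType.

Definition ratF := {fraction {poly F}}.

Definition pfrac (p : {poly F}) : ratF := @FracField.tofrac {poly F} p.
Definition cfrac (c : F) : ratF := pfrac c%:P.
Definition Xf : ratF := pfrac 'X.

Definition rfun (g h : {poly F}) : ratF := pfrac g / pfrac h.

Definition peval (p : {poly F}) (r : ratF) : ratF := (map_poly cfrac p).[r].

Definition rcomp (g h : {poly F}) (r : ratF) : ratF := peval g r / peval h r.

Definition fiter (g h : {poly F}) (k : nat) : ratF := iter k (rcomp g h) Xf.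

Definition pdeg (p : {poly F}) : nat := (size p).-1.

Definition is_deg (r : ratF) (n : nat) : Prop :=
  exists a b : {poly F}, [/\ b != 0, coprimep a b, r = rfun a b &
                             n = maxn (pdeg a) (pdeg b)].

Definition is_zero_of (r : ratF) (x : F) : Prop :=
  exists a b : {poly F}, [/\ b != 0, coprimep a b, r = rfun a b & root a x].

(* Psi_ge g h n m : Psi(n) >= m, where
   Psi(n) = min over k_1..k_n in Z with k_n <> 0 of
            deg ((f^(1))^k_1 * ... * (f^(n))^k_n).
   Exponent k_(i+1) is encoded as k i. *)
Definition Psi_ge (g h : {poly F}) (n m : nat) : Prop :=
  forall k : nat -> int, k n.-1 != 0 ->
  forall D, is_deg (\prod_(i < n) (fiter g h i.+1) ^ (k i)) D -> (m <= D)%N.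

Definition deg1 (a b : {poly F}) : Prop :=
  [/\ b != 0, coprimep a b & maxn (pdeg a) (pdeg b) = 1%N].

Definition lin_conj (g h u v : {poly F}) : Prop :=
  exists a b a' b' : {poly F},
    [/\ deg1 a b, deg1 a' b',
        rcomp a' b' (rfun a b) = Xf, rcomp a b (rfun a' b') = Xf &
        rfun g h = rcomp a' b' (rcomp u v (rfun a b))].

Definition is_monomial (g h : {poly F}) : Prop :=
  exists (c : F) (m : int), c != 0 /\ rfun g h = cfrac c * Xf ^ m.

Definition is_pbinomial (g h : {poly F}) : Prop :=
  exists (p : nat) (a b : F) (l : nat),
    [/\ p \in [pchar F], a != 0 & rfun g h = cfrac a * Xf ^+ (p ^ l) + cfrac b].

(* f = g/h is separable: f' = (g'h - gh')/h^2 is nonzero *)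
Definition separable_rf (g h : {poly F}) : Prop :=
  g^`() * h - g * h^`() != 0.

Definition is_L_of_frob (g h : {poly F}) : Prop :=
  exists (a b : {poly F}) (p l : nat),
    [/\ deg1 a b, p \in [pchar F], (1 <= l)%N &
        rfun g h = rcomp a b (Xf ^+ (p ^ l))].

End RatFun.

(* Main.v *)
Require Import Defs.
From HB Require Import structures.
From mathcomp Require Import all_boot all_order all_algebra all_field.
From mathcomp Require Import ring zify.
From Stdlib Require Import Classical_Prop.
Import Order.TTheory GRing.Theory Num.Theory.
Set Implicit Arguments. Unset Strict Implicit. Unset Printing Implicit Defensive.
Local Open Scope ring_scope.

(* A point of P^1 counted among the zeros (or poles) of f^(n), but whose iterates
   of order 0 < i < n avoid {0, oo}, is a zero (or pole) of the whole product, so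
   the degree of the product is at least the number of such points.

   If some b in {0, oo} is never reached from {0, oo}, all d^n preimages of b
   under f^(n) qualify.  Otherwise 0 and oo are both periodic, and f is injective
   on their orbits.  If some x on these orbits is not the only preimage of f(x),
   the other preimages lie off the cycles; their preimages under f^(n-t) qualify,
   where t is the time at which they first meet {0, oo}, which gives d^(n-t).
   If all the points of the cycles are totally ramified then either {0, oo} is
   the whole cycle set and f is a monomial, or there is a third point (x : y),
   (yX - xY)^d lies in the span of X^d and Y^d, d is a power of p, and
   f = L(X^d) with L of degree 1.

   Points of P^1 are vectors of homogeneous coordinates, and polynomials stand for
   binary forms of a prescribed degree.  Only 0, oo and their orbits, which are
   rational, are named as points; the other preimages appear only through the form
   vanishing at them, tested at points of arbitrary field extensions. *)

(* The value at w of the binary form of degree N that dehomogenizes to p; it is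
   meaningful when size p <= N.+1, higher coefficients being ignored. *)
Definition hev (R : comNzRingType) (N : nat) (p : {poly R}) (w : R * R) : R :=
  \sum_(i < N.+1) p`_i * (w.1 ^+ i * w.2 ^+ (N - i)).

Definition Phi (R : comNzRingType) (d : nat) (g h : {poly R}) (w : R * R) : R * R :=
  (hev d g w, hev d h w).

(* true stands for oo = (1 : 0) and false for 0 = (0 : 1). *)
Definition pt (R : comNzRingType) (b : bool) : R * R := if b then (1, 0) else (0, 1).

(* The coordinate vanishing at pt b. *)
Definition co (R : Type) (b : bool) (w : R * R) : R := if b then w.2 else w.1.

Definition scv (R : comNzRingType) (l : R) (w : R * R) : R * R := (l * w.1, l * w.2).

Definition mapv (R S : Type) (f : R -> S) (w : R * R) : S * S := (f w.1, f w.2).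

(** * Binary forms of a prescribed degree *)

Section Forms.
Variable R : comNzRingType.
Implicit Types (p q u v : {poly R}) (w : R * R).

Lemma hev_linear N (a : R) p q w :
  hev N (a *: p + q) w = a * hev N p w + hev N q w.
Proof.
rewrite /hev mulr_sumr -big_split; apply: eq_bigr => i _ /=.
rewrite coefD coefZ; ring.
Qed.

Lemma hev0 N w : hev N 0 w = 0.
Proof. by rewrite /hev big1 // => i _; rewrite coef0 mul0r. Qed.

Lemma hevD N p q w : hev N (p + q) w = hev N p w + hev N q w.
Proof. by rewrite -[p]scale1r hev_linear mul1r scale1r. Qed.

Lemma hevZ N a p w : hev N (a *: p) w = a * hev N p w.
Proof. by rewrite -[a *: p]addr0 hev_linear hev0 addr0. Qed.

Lemma hev_sum N (I : Type) (r : seq I) (P : pred I) (E : I -> {poly R}) w :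
  hev N (\sum_(i <- r | P i) E i) w = \sum_(i <- r | P i) hev N (E i) w.
Proof. exact: (big_morph (fun p => hev N p w) (fun p q => hevD N p q w) (hev0 N w)). Qed.

Lemma hevXn N k w : (k <= N)%N -> hev N 'X^k w = w.1 ^+ k * w.2 ^+ (N - k).
Proof.
move=> kN; have kN' : (k < N.+1)%N by rewrite ltnS.
rewrite /hev (bigD1 (Ordinal kN')) //= coefXn eqxx mul1r big1 ?addr0 // => i.
by rewrite -val_eqE coefXn /= => /negPf ->; rewrite mul0r.
Qed.

Lemma poly_wide N p : (size p <= N.+1)%N -> p = \sum_(i < N.+1) p`_i *: 'X^i.
Proof.
move=> sp; rewrite -poly_def; apply/polyP=> i; rewrite coef_poly.
by case: ltnP => // /(leq_trans sp) /leq_sizeP ->.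
Qed.

Lemma hevM M N p q w : (size p <= M.+1)%N -> (size q <= N.+1)%N ->
  hev (M + N) (p * q) w = hev M p w * hev N q w.
Proof.
move=> sp sq; rewrite {1}(poly_wide sp) {1}(poly_wide sq) mulr_suml hev_sum.
rewrite [hev M p w]/hev mulr_suml; apply: eq_bigr => i _.
rewrite [hev N q w]/hev !mulr_sumr hev_sum; apply: eq_bigr => j _.
rewrite -scalerAl -scalerAr scalerA -exprD hevZ hevXn ?leq_add ?leq_ord //.
have -> : (M + N - (i + j) = (M - i) + (N - j))%N by have := ltn_ord i; have := ltn_ord j; lia.
rewrite !exprD; ring.
Qed.

Lemma size_formM M N p q : (size p <= M.+1)%N -> (size q <= N.+1)%N ->
  (size (p * q)%R <= (M + N).+1)%N.
Proof.
move=> sp sq; apply: leq_trans (size_polyMleq _ _) _.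
by move: sp sq; lia.
Qed.

(** The size bound is proved together with the value because [hevM] asks for it at each step of the
    induction. *)
Lemma hev_pow N k p w : (size p <= N.+1)%N ->
  (size (p ^+ k)%R <= (k * N).+1)%N /\ hev (k * N) (p ^+ k) w = hev N p w ^+ k.
Proof.
move=> sp; elim: k => [|k [IHs IHe]].
  by rewrite mul0n !expr0 size_poly1 /hev big_ord1 coef1 !expr0 !mul1r.
by rewrite !exprS mulSn hevM // IHe; split=> //; apply: size_formM.
Qed.

Lemma hev_scv N p l w : hev N p (scv l w) = l ^+ N * hev N p w.
Proof.
rewrite /hev mulr_sumr; apply: eq_bigr => i _ /=.
have -> : l ^+ N = l ^+ i * l ^+ (N - i) by rewrite -exprD subnKC // -ltnS.
by rewrite !exprMn_comm; [ring | exact: mulrC..].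
Qed.

Lemma hev_affine N p (x : R) : (size p <= N.+1)%N -> hev N p (x, 1) = p.[x].
Proof.
move=> sp; rewrite (horner_coef_wide x sp) /hev; apply: eq_bigr => i _ /=.
by rewrite expr1n mulr1.
Qed.

Lemma hev_infty N p : hev N p (1, 0) = p`_N.
Proof.
rewrite /hev big_ord_recr /= subnn !expr1n expr0 !mulr1 big1 ?add0r // => i _ /=.
by rewrite expr1n expr0n subn_eq0 leqNgt ltn_ord /= !mulr0.
Qed.

Lemma iter_Phi_scv d p q n l w :
  iter n (Phi d p q) (scv l w) = scv (l ^+ (d ^ n)) (iter n (Phi d p q) w).
Proof.
elim: n => [|n IH]; first by rewrite expn0 expr1.
by rewrite !iterS IH /Phi !hev_scv /scv /= -exprM -expnSr.
Qed.

End Forms.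

(** * Change of coefficients along a ring morphism *)

Section Morph.
Variables (R S : comNzRingType) (f : {rmorphism R -> S}).

Lemma hev_map N p w : hev N (map_poly f p) (mapv f w) = f (hev N p w).
Proof.
rewrite /hev rmorph_sum; apply: eq_bigr => i _ /=.
by rewrite coef_map !rmorphM !rmorphXn.
Qed.

Lemma iter_Phi_map d g h n w :
  iter n (Phi d (map_poly f g) (map_poly f h)) (mapv f w) =
  mapv f (iter n (Phi d g h) w).
Proof. by elim: n => //= n ->; rewrite /Phi !hev_map. Qed.

Lemma mapv_pt b : mapv f (pt R b) = pt S b.
Proof. by case: b; rewrite /mapv /pt /= rmorph1 rmorph0. Qed.

Lemma co_mapv b w : co b (mapv f w) = f (co b w).
Proof. by case: b. Qed.
End Morph.

(** * Composition of forms *)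

Section Compose.
Variables (R S : comNzRingType) (f : {rmorphism R -> S}).
Implicit Types (p u v : {poly R}).

Lemma size_map_leq p : (size (map_poly f p) <= size p)%N.
Proof. by rewrite map_polyE (leq_trans (size_Poly _)) // size_map. Qed.

(** Substituting two forms into a form is evaluation over the ring of polynomials, so the lemmas on
    [hev] cover composition as well. *)
Definition hcomp N p u v : {poly R} := hev N (map_poly polyC p) (u, v).

Lemma hcomp_size N M p u v : (size u <= M.+1)%N -> (size v <= M.+1)%N ->
  (size (hcomp N p u v) <= (N * M).+1)%N.
Proof.
move=> su sv; rewrite /hcomp /hev; apply: (leq_trans (size_sum _ _ _)).
apply/bigmax_leqP => i _ /=; rewrite coef_map /= mul_polyC.
apply: (leq_trans (size_scale_leq _ _)).
have -> : (N * M = i * M + (N - i) * M)%N by rewrite -mulnDl subnKC // -ltnS.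
by apply: size_formM; apply: (hev_pow _ (0, 0) _).1.
Qed.

Lemma hev_hcomp N M p u v (w : S * S) : (size u <= M.+1)%N -> (size v <= M.+1)%N ->
  hev (N * M) (map_poly f (hcomp N p u v)) w =
  hev N (map_poly f p) (hev M (map_poly f u) w, hev M (map_poly f v) w).
Proof.
move=> su sv; rewrite /hcomp {2 3}/hev rmorph_sum hev_sum; apply: eq_bigr => i _ /=.
rewrite !coef_map /= mul_polyC map_polyZ hevZ /= rmorphM !rmorphXn /=.
have -> : (N * M = i * M + (N - i) * M)%N by rewrite -mulnDl subnKC // -ltnS.
have su' := leq_trans (size_map_leq u) su; have sv' := leq_trans (size_map_leq v) sv.
by rewrite hevM ?(hev_pow _ w su').2 ?(hev_pow _ w sv').2 //; apply: (hev_pow _ w _).1.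
Qed.
End Compose.

(** * Homogenized iterates *)

Section Iterates.
Variables (F : fieldType) (g h : {poly F}) (d : nat).

(* The homogenized numerator and denominator of the n-th iterate. *)
Definition itp n : {poly F} * {poly F} :=
  iter n (Phi d (map_poly polyC g) (map_poly polyC h)) ('X, 1).

Lemma itpS n : itp n.+1 =
  (hcomp d g (itp n).1 (itp n).2, hcomp d h (itp n).1 (itp n).2).
Proof. by rewrite /hcomp -surjective_pairing. Qed.

Lemma itp_size n b : (size (co b (itp n)) <= (d ^ n).+1)%N.
Proof.
elim: n b => [|n IH] b; first by case: b; rewrite /= ?size_polyX ?size_poly1.
rewrite itpS expnS; have su := IH false; have sv := IH true.
by case: b; apply: hcomp_size.
Qed.

Lemma hev_itp (S : comNzRingType) (f : {rmorphism F -> S}) n b w :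
  hev (d ^ n) (map_poly f (co b (itp n))) w =
  co b (iter n (Phi d (map_poly f g) (map_poly f h)) w).
Proof.
elim: n b => [|n IH] b.
  case: b; rewrite /= ?rmorph1 ?map_polyX expn0.
    by rewrite -[1](expr0 'X) hevXn //= expr0 mul1r subn0 expr1.
  by rewrite -['X]expr1 hevXn //= subnn expr0 mulr1 expr1.
have su := itp_size n false; have sv := itp_size n true.
have Hu := IH false; have Hv := IH true.
rewrite /= in Hu Hv; rewrite iterS expnS [X in Phi _ _ _ X]surjective_pairing -Hu -Hv itpS.
by case: b; apply: hev_hcomp.
Qed.

(** This is [hev_itp] for the morphism [polyC], at the point of {poly F} x {poly F} given by the
    n-th pair itself. *)
Lemma itp_add n m b : co b (itp (m + n)) = hcomp (d ^ m) (co b (itp m)) (itp n).1 (itp n).2.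
Proof. by rewrite /hcomp -surjective_pairing hev_itp /itp iterD. Qed.
End Iterates.

(** * Common roots and points of the projective line *)

(** A nonconstant gcd has an irreducible factor, which acquires a root in the extension obtained by
    adjoining one; that root is common to [p] and [q]. *)
Lemma coprimep_no_common_root (F : fieldType) (p q : {poly F}) :
  (forall (L : fieldType) (f : {rmorphism F -> L}) (x : L),
     root (map_poly f p) x -> root (map_poly f q) x -> False) ->
  coprimep p q.
Proof.
have irr_dvd n (r : {poly F}) : (size r <= n)%N -> (1 < size r)%N ->
    exists2 s, irreducible_poly s & s %| r.
  elim: n r => [|n IH] r rn r1; first by move: rn r1; lia.
  (* Over an arbitrary field, irreducibility is settled by excluded middle. *)
  case: (classic (irreducible_poly r)) => [ir|nir]; first by exists r.
  have [s [sr s1 nsr]] : exists s, [/\ s %| r, size s != 1%N & ~~ (s %= r)].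
    apply: NNPP => H; apply: nir; split=> // s s1 sr.
    by apply/negPn/negP => nsr; apply: H; exists s.
  have r0 : r != 0 by rewrite -size_poly_gt0; lia.
  have s0 : s != 0 by apply: contraNneq r0 => s0; rewrite -dvd0p -s0.
  have ltsr : (size s < size r)%N.
    rewrite ltn_neqAle dvdp_leq // andbT; apply: contraNneq nsr => /eqP e.
    by rewrite -dvdp_size_eqp.
  have [|t it ts] := IH s (leq_trans ltsr rn : (size s <= n)%N).
    by rewrite ltn_neqAle eq_sym s1 size_poly_gt0.
  by exists t => //; apply: dvdp_trans sr.
move=> H; apply: contraT => npq.
have [g0|g0] := eqVneq (gcdp p q) 0.
  move/eqP: g0; rewrite gcdp_eq0 => /andP [/eqP p0 /eqP q0].
  by case: (H F idfun 0); rewrite ?p0 ?q0 rmorph0 root0.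
have g1 : (1 < size (gcdp p q))%N.
  by rewrite ltn_neqAle eq_sym npq size_poly_gt0.
have [s is_ sg] := irr_dvd _ _ (leqnn _) g1.
have [L _ [z sz _]] := irredp_FAdjoin is_.
have /andP [sp sq] : (s %| p) && (s %| q) by rewrite -dvdp_gcd.
by case: (H L (in_alg L) z); apply: root_dvdp sz; rewrite dvdp_map.
Qed.

Definition nz (R : comNzRingType) (w : R * R) := (w.1 != 0) || (w.2 != 0).

Lemma nz_co (R : comNzRingType) b (w : R * R) :
  nz w -> co b w = 0 -> co (~~ b) w = 0 -> False.
Proof. by rewrite /nz; case: b => /= + e1 e2; rewrite e1 e2 eqxx. Qed.

Section Projective.
Variable L : fieldType.
Implicit Types (u v w : L * L) (p : {poly L}).

(** On nonzero vectors this is equality of points of P^1. *)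
Definition par u w := exists2 l : L, l != 0 & u = scv l w.

Lemma par_refl u : par u u.
Proof. by exists 1; rewrite ?oner_neq0 // /scv !mul1r; case: u. Qed.

Lemma par_sym u w : par u w -> par w u.
Proof.
case=> l l0 ->; exists l^-1; rewrite ?invr_eq0 //.
by rewrite /scv /= !mulKf //; case: w.
Qed.

Lemma par_trans v u w : par u v -> par v w -> par u w.
Proof.
case=> l l0 -> [m m0 ->]; exists (l * m); first by rewrite mulf_neq0.
by rewrite /scv /= !mulrA.
Qed.

Lemma det_par u w : nz u -> nz w -> u.2 * w.1 = u.1 * w.2 -> par u w.
Proof.
case: u w => [a b] [x y]; rewrite /nz /= => nu nw e.
have [x0|x0] := eqVneq x 0.
  have y0 : y != 0 by move: nw; rewrite x0 eqxx.
  move/eqP: e; rewrite x0 mulr0 eq_sym mulf_eq0 (negPf y0) orbF => /eqP a0.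
  have b0 : b != 0 by move: nu; rewrite a0 eqxx.
  exists (b / y); first by rewrite mulf_neq0 ?invr_eq0.
  by rewrite /scv /= mulr0 divfK // a0.
exists (a / x).
  rewrite mulf_neq0 ?invr_eq0 //; apply: contraTneq nu => a0.
  by move/eqP: e; rewrite a0 mul0r mulf_eq0 (negPf x0) orbF eqxx => /eqP ->; rewrite eqxx.
by rewrite /scv /= divfK //; congr pair; rewrite mulrAC -e mulfK.
Qed.

Lemma nz_pt b : nz (pt L b).
Proof. by case: b; rewrite /nz /= oner_neq0 ?orbT. Qed.

Lemma co_par b w : nz w -> co b w = 0 -> par w (pt L b).
Proof.
by move=> nw c0; apply: det_par (nz_pt b) _ => //; case: b c0 => /= ->; ring.
Qed.

Lemma par_co b w : par w (pt L b) -> co b w = 0.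
Proof. by case=> l _ ->; case: b => /=; rewrite mulr0. Qed.

Lemma co_pt b c : (co b (pt L c) == 0) = (b == c).
Proof. by case: b; case: c; rewrite /= ?eqxx ?oner_eq0. Qed.

Lemma hev_par N p u w : par u w -> hev N p u = 0 -> hev N p w = 0.
Proof.
case=> l l0 -> /eqP; rewrite hev_scv mulf_eq0 => /orP [|/eqP //].
by rewrite expf_eq0 (negPf l0) andbF.
Qed.

Lemma iter_par d p q n u w : par u w ->
  par (iter n (Phi d p q) u) (iter n (Phi d p q) w).
Proof.
by case=> l l0 ->; exists (l ^+ (d ^ n)); rewrite ?expf_neq0 ?iter_Phi_scv.
Qed.

Lemma hev_frac N p (x y : L) : (size p <= N.+1)%N -> y != 0 ->
  hev N p (x, y) = y ^+ N * p.[x / y].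
Proof.
move=> sp y0; rewrite -(hev_affine _ sp) -hev_scv /scv /= mulr1.
by rewrite mulrC divfK.
Qed.

Definition regular d p q := forall w, nz w -> nz (Phi d p q w).

Lemma regular_iter d p q n w : regular d p q -> nz w -> nz (iter n (Phi d p q) w).
Proof. by move=> r nw; elim: n => //= n; apply: r. Qed.

(** A common zero at infinity is excluded because one of the two polynomials has degree exactly d, a
    finite one by coprimality. *)
Lemma coprime_regular d p q : coprimep p q -> maxn (size p) (size q) = d.+1 ->
  regular d p q.
Proof.
move=> cpq dpq [x y] nw.
have [sp sq] : (size p <= d.+1)%N /\ (size q <= d.+1)%N by move: dpq; lia.
have [y0|y0] := eqVneq y 0.
  have x0 : x != 0 by move: nw; rewrite /nz y0 eqxx orbF.
  have -> : (x, y) = scv x (1, 0) by rewrite /scv /= mulr1 mulr0 y0.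
  rewrite /nz /= !hev_scv !hev_infty !mulf_eq0 !expf_eq0 (negPf x0) !andbF /=.
  have [e|e] : size p = d.+1 \/ size q = d.+1 by move: dpq; lia.
    by have := lead_coef_eq0 p; rewrite lead_coefE e /= => ->; rewrite -size_poly_eq0 e.
  by have := lead_coef_eq0 q; rewrite lead_coefE e /= => ->; rewrite -size_poly_eq0 e orbT.
rewrite /nz /= !hev_frac // !mulf_eq0 !expf_eq0 (negPf y0) !andbF /= -negb_and.
apply/negP => /andP [rp rq].
by have := coprimep_root cpq rp; rewrite rq.
Qed.
End Projective.

(** * The iterates of f in lowest terms *)

Section System.
Variables (F : fieldType) (g h : {poly F}) (d : nat).
Hypothesis cgh : coprimep g h.
Hypothesis dgh : maxn (size g) (size h) = d.+1.
Hypothesis d0 : (0 < d)%N.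

Let sg : (size g <= d.+1)%N. Proof. by rewrite -dgh leq_maxl. Qed.
Let sh : (size h <= d.+1)%N. Proof. by rewrite -dgh leq_maxr. Qed.

Lemma regular_map (L : fieldType) (f : {rmorphism F -> L}) :
  regular d (map_poly f g) (map_poly f h).
Proof. by apply: coprime_regular; rewrite ?coprimep_map ?size_map_poly. Qed.

Lemma regular_id : regular d g h.
Proof. exact: coprime_regular. Qed.

Notation itp := (itp g h d).

Lemma itp_horner (L : fieldType) (f : {rmorphism F -> L}) n b x :
  (map_poly f (co b (itp n))).[x] =
  co b (iter n (Phi d (map_poly f g) (map_poly f h)) (x, 1)).
Proof. by rewrite -[RHS]hev_itp hev_affine ?size_map_poly ?itp_size. Qed.

Lemma itp_infty n b : (co b (itp n))`_(d ^ n) = co b (iter n (Phi d g h) (1, 0)).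
Proof.
have := hev_itp g h d (@idfun F) n b (1, 0).
by rewrite !map_poly_id // hev_infty.
Qed.

Lemma itp_coprime n b : coprimep (co b (itp n)) (co (~~ b) (itp n)).
Proof.
apply: coprimep_no_common_root => L f x; rewrite !rootE !itp_horner.
have := regular_iter n (regular_map f) (_ : nz (x, 1)).
by rewrite /nz /= oner_eq0 orbT => /(_ isT); case: b => /=; do 2!case: eqP.
Qed.

(** If one coordinate were the zero polynomial, coprimality would make the other constant. Its
    coefficient of index d^n > 0 would then vanish, and the image of infinity would be (0, 0). *)
Lemma itp_neq0 n b : co b (itp n) != 0.
Proof.
apply/eqP => e; have := itp_coprime n b; rewrite e coprime0p => e1.
have nzi : nz (iter n (Phi d g h) (1, 0)) := regular_iter n regular_id (nz_pt F true).
have i1 := itp_infty n b; have i2 := itp_infty n (~~ b).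
have {}i1 : co b (iter n (Phi d g h) (1, 0)) = 0 by rewrite -i1 e coef0.
have {}i2 : co (~~ b) (iter n (Phi d g h) (1, 0)) = 0.
  rewrite -i2; apply: nth_default; rewrite (eqp_size e1) size_poly1.
  by rewrite expn_gt0 d0.
exact: nz_co nzi i1 i2.
Qed.

Lemma pfrac_eq0 (p : {poly F}) : (pfrac p == 0) = (p == 0).
Proof. exact: tofrac_eq0. Qed.

Lemma pevalE (p : {poly F}) r : peval p r = (map_poly (FracField.tofrac (R:={poly F}) \o polyC) p).[r].
Proof. by rewrite /peval; congr _.[_]; apply: eq_map_poly. Qed.

(** By homogeneity the next numerator and denominator are g(u/v) and h(u/v), each multiplied by the
    same factor v^d, which cancels in the quotient. *)
Lemma fiterE n : fiter g h n = rfun (itp n).1 (itp n).2.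
Proof.
elim: n => [|n IH]; first by rewrite /fiter /rfun /Xf /= /pfrac tofrac1 divr1.
have y0 : pfrac (itp n).2 != 0 by rewrite pfrac_eq0 (itp_neq0 n true).
have E (p : {poly F}) : (size p <= d.+1)%N ->
    pfrac (hcomp d p (itp n).1 (itp n).2) = pfrac (itp n).2 ^+ d * peval p (fiter g h n).
  move=> sp; rewrite IH /rfun pevalE -hev_frac //; last first.
    by rewrite size_map_poly.
  by rewrite map_poly_comp /pfrac -(hev_map _ _ _ (_, _)).
rewrite [fiter _ _ _]/= -/(fiter g h n) /rcomp itpS /rfun /= !E //.
by rewrite invfM mulrACA divff ?mul1r // expf_neq0.
Qed.
End System.

(** * From zeros of a form to a lower bound for the degree of the product *)

Section Degree.
Variable F : fieldType.
Implicit Types (p q a b R S T W u v : {poly F}).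

Lemma pdegM p q : p != 0 -> q != 0 -> pdeg (p * q) = (pdeg p + pdeg q)%N.
Proof.
by move=> p0 q0; rewrite /pdeg size_mul // (polySpred p0) (polySpred q0) /= addnS.
Qed.

Lemma pdegX p n : pdeg (p ^+ n) = (n * pdeg p)%N.
Proof. by rewrite /pdeg size_exp mulnC. Qed.

Lemma rfun_mul a b u v : rfun a b * rfun u v = rfun (a * u) (b * v).
Proof. by rewrite /rfun /pfrac !tofracM invfM mulrACA. Qed.

Lemma rfunV a b : (rfun a b)^-1 = rfun b a.
Proof. by rewrite /rfun invfM invrK mulrC. Qed.

Lemma rfunX a b n : rfun a b ^+ n = rfun (a ^+ n) (b ^+ n).
Proof. by rewrite /rfun /pfrac !tofracXn expr_div_n. Qed.

Lemma rfun_eq a b u v : b != 0 -> v != 0 -> rfun a b = rfun u v -> a * v = b * u.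
Proof.
move=> b0 v0 /eqP; rewrite /rfun eqr_div ?pfrac_eq0 // /pfrac -!tofracM tofrac_eq.
by move/eqP ->; rewrite mulrC.
Qed.

(** Here a/b = R^q T / W. Since [R] is coprime to [W], R^q divides [a], which suffices when deg R =
    M. Otherwise the form of degree M given by [R] also vanishes at infinity. The degree hypothesis
    then expresses the vanishing of a/b there, and comparing degrees in the equation gives deg b >=
    q M. *)
Lemma degree_factor a b R T W (M q : nat) :
  R != 0 -> T != 0 -> W != 0 -> a != 0 -> b != 0 -> (0 < q)%N ->
  a * W = b * (R ^+ q * T) -> coprimep R W -> (size R <= M.+1)%N ->
  (size R != M.+1 -> (pdeg T + q * M <= pdeg W)%N) ->
  (M <= maxn (pdeg a) (pdeg b))%N.
Proof.
move=> R0 T0 W0 a0 b0 q0 e cRW sR H.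
have Rq0 : R ^+ q != 0 by rewrite expf_neq0.
have /dvdpP [c ec] : R ^+ q %| a.
  have cRqW : coprimep (R ^+ q) W by rewrite coprimep_expl.
  rewrite -(Gauss_dvdpl a cRqW) e.
  by rewrite dvdp_mull // dvdp_mulr.
have c0 : c != 0 by apply: contraNneq a0 => c0; rewrite ec c0 mul0r.
have da : pdeg a = (pdeg c + q * pdeg R)%N by rewrite ec pdegM // pdegX.
have := congr1 (@pdeg F) e; rewrite !pdegM ?mulf_neq0 // pdegX => e2.
have [sR1|sR1] := eqVneq (size R) M.+1.
  have dR : pdeg R = M by rewrite /pdeg sR1.
  by rewrite leq_max da dR; move: q0; case: (q) => // q' _; rewrite mulSn; lia.
have := H sR1; rewrite leq_max => H1.
apply/orP; right; move: H1 e2 da; case: (q) q0 => // q' _; rewrite !mulSn; lia.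
Qed.

Variables (R : {poly F}) (flag : bool).

(* flag says that the form represented by R also vanishes at infinity. *)
Definition unit_along (r : ratF F) := exists u v,
  [/\ (u != 0) && (v != 0), coprimep R u, coprimep R v,
      (flag -> size u = size v) & r = rfun u v].

Lemma unit_along1 : unit_along 1.
Proof.
exists 1, 1; rewrite !oner_neq0 !coprimep1; split=> //.
by rewrite /rfun /pfrac tofrac1 divr1.
Qed.

Lemma unit_alongM r s : unit_along r -> unit_along s -> unit_along (r * s).
Proof.
case=> u [v [/andP [u0 v0] cu cv fl ->]] [u' [v' [/andP [u0' v0'] cu' cv' fl' ->]]].
exists (u * u'), (v * v'); rewrite !mulf_neq0 // !coprimepMr cu cv cu' cv'.
by split=> //; [move=> f; rewrite !size_mul // fl ?fl' | rewrite rfun_mul].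
Qed.

Lemma unit_alongV r : unit_along r -> unit_along r^-1.
Proof.
case=> u [v [/andP [u0 v0] cu cv fl ->]]; exists v, u; rewrite u0 v0 rfunV.
by split=> // /fl.
Qed.

Lemma unit_alongXz r (k : int) : unit_along r -> unit_along (r ^ k).
Proof.
have H s n : unit_along s -> unit_along (s ^+ n).
  move=> us; elim: n => [|n IH]; first exact: unit_along1.
  by rewrite exprS; apply: unit_alongM.
by case: k => n ur; [apply: H | apply: unit_alongV; apply: H].
Qed.
End Degree.

Section System.
Variables (F : fieldType) (g h : {poly F}) (d : nat).
Hypothesis cgh : coprimep g h.
Hypothesis dgh : maxn (size g) (size h) = d.+1.
Hypothesis d0 : (0 < d)%N.
Notation itp := (itp g h d).

Lemma itp_size_eq n b : co b (iter n (Phi d g h) (1, 0)) <> 0 ->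
  size (co b (itp n)) = (d ^ n).+1.
Proof.
move=> c0; apply/eqP; rewrite eqn_leq itp_size /=.
by apply: contra_notT c0; rewrite -leqNgt -itp_infty => /leq_sizeP ->.
Qed.

(** The zeros of the form [R] of degree M are zeros of coordinate b of f^(n) whose earlier iterates
    avoid {0, oo}. Hence the factors f^(i) with i < n are units along [R], and the last factor is a
    nonzero power of a fraction with [R] in its numerator; [degree_factor] concludes. *)
Lemma degree_bound n b (R S : {poly F}) M :
  (0 < n)%N -> co b (itp n) = R * S -> (size R <= M.+1)%N -> (M <= d ^ n)%N ->
  (size S <= (d ^ n - M).+1)%N ->
  (forall (L : fieldType) (f : {rmorphism F -> L}) (w : L * L), nz w ->
     hev M (map_poly f R) w = 0 -> forall i c, (0 < i < n)%N ->
     co c (iter i (Phi d (map_poly f g) (map_poly f h)) w) <> 0) ->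
  Psi_ge g h n M.
Proof.
case: n => // n _ eRS sR Mn sS HR k kn D [a [b' [b0 cab er ->]]].
rewrite [n.+1.-1]/= in kn.
have RS0 := itp_neq0 cgh dgh d0 n.+1 b; have V0 := itp_neq0 cgh dgh d0 n.+1 (~~ b).
have cRV : coprimep R (co (~~ b) (itp n.+1)).
  by apply: coprimep_dvdr (itp_coprime cgh dgh n.+1 b); rewrite eRS dvdp_mulr.
rewrite eRS mulf_eq0 negb_or in RS0; case/andP: RS0 => R0 S0.
set flag := size R != M.+1.
have fR : flag -> hev M R (1, 0) = 0.
  by move=> fl; rewrite hev_infty nth_default // -ltnS ltn_neqAle sR andbT.
(* If [R] vanishes at infinity then so does coordinate b of the iterate. The other coordinate does
   not, so its degree is the largest possible. *)
have fV : flag -> pdeg (co (~~ b) (itp n.+1)) = (d ^ n.+1)%N.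
  move=> /fR fl; rewrite /pdeg itp_size_eq // => e2.
  have : co b (iter n.+1 (Phi d g h) (1, 0)) = 0.
    by rewrite -itp_infty eRS -hev_infty -(subnKC Mn) hevM // fl mul0r.
  have nzi : nz (iter n.+1 (Phi d g h) (1, 0)) :=
    regular_iter n.+1 (regular_id cgh dgh) (nz_pt F true).
  by move=> e1; exact: nz_co nzi e1 e2.
have uf i : (0 < i < n.+1)%N -> unit_along R flag (fiter g h i).
  move=> Hi; rewrite (fiterE cgh dgh d0); exists (itp i).1, (itp i).2.
  have cR c : coprimep R (co c (itp i)).
    apply: coprimep_no_common_root => L f x Rx; rewrite rootE itp_horner => /eqP.
    apply: HR Hi; first by rewrite /nz /= oner_eq0 orbT.
    by rewrite hev_affine ?size_map_poly //; apply/eqP.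
  rewrite (itp_neq0 cgh dgh d0 i false) (itp_neq0 cgh dgh d0 i true).
  split=> //; [exact: cR false | exact: cR true |].
  move=> /fR fl; have Hc c : co c (iter i (Phi d g h) (1, 0)) <> 0.
    have := HR F idfun (1, 0) (nz_pt F true); rewrite !map_poly_id //; exact.
  by rewrite (itp_size_eq (Hc false)) (itp_size_eq (Hc true)).
have uP : unit_along R flag (\prod_(i < n) fiter g h i.+1 ^ k i).
  elim/big_ind: _ => [||i _]; [exact: unit_along1|exact: unit_alongM|].
  by apply: unit_alongXz; apply: uf; rewrite /= ltnS.
(* [fb] is the iterate or its inverse, according to b, so that [R] always sits in the numerator. *)
pose fb := rfun (R * S) (co (~~ b) (itp n.+1)).
have [m m0 efb] : exists2 m : int, m != 0 & fiter g h n.+1 ^ k n = fb ^ m.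
  rewrite (fiterE cgh dgh d0) /fb -eRS; case: (b); last by exists (k n).
  by exists (- k n); rewrite ?oppr_eq0 // -[RHS]exprz_inv rfunV.
have Hq (r : ratF F) (q : nat) (x y : {poly F}) : (0 < q)%N -> unit_along R flag r -> y != 0 ->
    rfun x y = r * fb ^+ q -> (M <= maxn (pdeg x) (pdeg y))%N.
  move=> q0 [u [v [/andP [u0 v0] cu cv fl ->]]] y0.
  rewrite /fb rfunX rfun_mul => exy.
  have W0 : v * co (~~ b) (itp n.+1) ^+ q != 0 by rewrite mulf_neq0 ?expf_neq0.
  have T0 : S ^+ q * u != 0 by rewrite mulf_neq0 ?expf_neq0.
  have e := rfun_eq y0 W0 exy.
  have x0 : x != 0.
    apply: contraNneq T0 => x0; move/esym/eqP: e; rewrite x0 mul0r.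
    by rewrite exprMn !mulf_eq0 !expf_eq0 (negPf y0) (negPf u0) (negPf R0) (negPf S0) !andbF.
  apply: (@degree_factor _ x y R (S ^+ q * u) (v * co (~~ b) (itp n.+1) ^+ q) M q) => //.
  - by rewrite e exprMn [u * _]mulrC -mulrA.
  - by rewrite coprimepMr cv coprimep_expr.
  (* As deg u = deg v here, what remains is deg S + M <= d^(n+1), multiplied by q. *)
  move=> fl1; rewrite !pdegM ?expf_neq0 // !pdegX fV // /pdeg fl //.
  rewrite addnAC -mulnDr addnC leq_add2l leq_mul2l; apply/orP; right.
  by rewrite -[X in (_ <= X)%N](subnK Mn) leq_add2r -ltnS -(polySpred S0).
rewrite big_ord_recr /= efb in er.
have [q q0 [em|em]] : exists2 q : nat, (0 < q)%N & m = q%:Z \/ m = - q%:Z.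
  by case: m m0 {efb er} => q q0; [exists q; [case: (q) q0|left] | exists q.+1; [|right; rewrite NegzE]].
  by apply: Hq q0 uP b0 _; rewrite -er em.
have a0 : a != 0.
  have : \prod_(i < n) fiter g h i.+1 ^ k i * fb ^ m != 0.
    have nzr r : unit_along R flag r -> r != 0.
      by case=> u [v [/andP [u0 v0] _ _ _ ->]]; rewrite /rfun mulf_neq0 ?invr_eq0 ?pfrac_eq0.
    apply: mulf_neq0 (nzr _ uP) _; apply: expfz_neq0.
    by rewrite /fb /rfun mulf_eq0 invr_eq0 !pfrac_eq0 mulf_eq0 (negPf R0) (negPf S0) (negPf V0).
  by rewrite er /rfun mulf_eq0 negb_or pfrac_eq0 => /andP [].
(* For a negative exponent the argument is applied to the inverse of the product, which has the same
   degree. *)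
rewrite maxnC; apply: Hq q0 (unit_alongV uP) a0 _.
by rewrite -rfunV -er invfM em invr_expz opprK.
Qed.
End System.

Lemma co0_par (L : fieldType) b (u w : L * L) : par u w -> co b u = 0 -> co b w = 0.
Proof. by case=> l l0 -> /eqP; case: b; rewrite /= mulf_eq0 (negPf l0) => /eqP. Qed.

(** * Linear factors of forms and multiplicities *)

Section LinearForms.
Variable F : fieldType.
Implicit Types (p q : {poly F}) (c : F * F).

(* The linear form y X - x Y vanishing at (x, y), with Y set to 1. *)
Definition ell c : {poly F} := c.2 *: 'X - c.1%:P.

Lemma ell_size c : (size (ell c) <= 2)%N.
Proof.
rewrite /ell (leq_trans (size_polyD _ _)) // geq_max size_polyN.
by rewrite (leq_trans (size_scale_leq _ _)) ?size_polyX // (leq_trans (size_polyC_leq1 _)).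
Qed.

Lemma form_factor N p c : nz c -> (size p <= N.+2)%N -> hev N.+1 p c = 0 ->
  exists2 q : {poly F}, (size q <= N.+1)%N & p = ell c * q.
Proof.
(* At infinity [ell] is the constant -x, and vanishing means that the top coefficient is zero: the
   cofactor is a multiple of [p] itself, with a smaller degree bound. Elsewhere this is the usual
   factor theorem. *)
case: c => [x y] nc sp; have [y0|y0] := eqVneq y 0.
  have x0 : x != 0 by move: nc; rewrite /nz y0 eqxx orbF.
  have -> : (x, y) = scv x (1, 0) by rewrite /scv /= mulr1 mulr0 y0.
  rewrite hev_scv hev_infty => /eqP; rewrite mulf_eq0 expf_eq0 (negPf x0) andbF /= => /eqP e.
  exists ((- x)^-1 *: p).
    rewrite (leq_trans (size_scale_leq _ _)) //; apply/leq_sizeP => j.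
    rewrite leq_eqVlt => /orP [/eqP <- //|]; exact: (leq_sizeP _ _ sp).
  rewrite /ell /scv /= !mulr0 scale0r mulr1 sub0r -polyCN mul_polyC scalerA.
  by rewrite divff ?oppr_eq0 // scale1r.
rewrite hev_frac // => /eqP; rewrite mulf_eq0 expf_eq0 (negPf y0) andbF /= => rp.
have /factor_theorem [q eq] : root p (x / y) by [].
exists (y^-1 *: q).
  rewrite (leq_trans (size_scale_leq _ _)) //.
  have [->|q0] := eqVneq q 0; first by rewrite size_poly0.
  by move: sp; rewrite eq size_Mmonic ?monicXsubC // size_XsubC addn2.
rewrite eq /ell /= mulrC -scalerAr scalerAl; congr (_ * _).
by rewrite scalerBr scalerA mulVf // scale1r -mul_polyC -polyCM mulrC.
Qed.

Lemma form_mult N p c : nz c -> (size p <= N.+1)%N -> p != 0 ->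
  exists (m : nat) (q : {poly F}), [/\ (m <= N)%N, (size q <= (N - m).+1)%N, p = ell c ^+ m * q &
                  hev (N - m) q c != 0].
Proof.
move=> nc; elim: N p => [|N IH] p sp p0.
  exists 0%N, p; split=> //; first by rewrite mul1r.
  rewrite /hev big_ord1 !expr0 !mulr1; apply: contraNneq p0 => e.
  by rewrite [p]size1_polyC // e.
have [e|ne] := eqVneq (hev N.+1 p c) 0; last first.
  by exists 0%N, p; rewrite subn0 mul1r; split.
have [q sq eq] := form_factor nc sp e.
have q0 : q != 0 by apply: contraNneq p0 => q0; rewrite eq q0 mulr0.
have [m [r [mN sr er hr]]] := IH q sq q0.
by exists m.+1, r; rewrite subSS; split=> //; rewrite eq er exprS mulrA.
Qed.

Lemma hev_ell (S : comNzRingType) (f : {rmorphism F -> S}) c w :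
  hev 1 (map_poly f (ell c)) w = f c.2 * w.1 - f c.1 * w.2.
Proof.
rewrite /hev !big_ord_recr big_ord0 /= add0r !coef_map /ell !coefB !coefZ !coefX !coefC /=.
by rewrite mulr0 mulr1 sub0r subr0 rmorphN; ring.
Qed.
End LinearForms.

(** * Preimages of the orbits of 0 and infinity *)

Section Dynamics.
Variables (F : fieldType) (g h : {poly F}) (d : nat).
Hypothesis cgh : coprimep g h.
Hypothesis dgh : maxn (size g) (size h) = d.+1.
Hypothesis d0 : (0 < d)%N.
Notation itp := (itp g h d).
Notation Ph := (Phi d g h).

Let sg : (size g <= d.+1)%N. Proof. by rewrite -dgh leq_maxl. Qed.
Let sh : (size h <= d.+1)%N. Proof. by rewrite -dgh leq_maxr. Qed.

Lemma Psi_ge_le n m m' : (m' <= m)%N -> Psi_ge g h n m -> Psi_ge g h n m'.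
Proof. by move=> mm H k kn D HD; apply: leq_trans mm (H k kn D HD). Qed.

Lemma iter_pt_map (L : fieldType) (f : {rmorphism F -> L}) s c :
  iter s (Phi d (map_poly f g) (map_poly f h)) (pt L c) = mapv f (iter s Ph (pt F c)).
Proof. by rewrite -(mapv_pt f) iter_Phi_map. Qed.

(** All d^n zeros of coordinate b of f^(n) qualify: if the i-th iterate of one of them were c in {0,
    oo}, then c would reach b in n - i steps. *)
Lemma not_reached_bound n b : (0 < n)%N ->
  (forall a s, (0 < s < n)%N -> co b (iter s Ph (pt F a)) <> 0) ->
  Psi_ge g h n (d ^ n).
Proof.
move=> n0 H; apply: (@degree_bound _ g h d cgh dgh d0 n b (co b (itp n)) 1) => //.
- by rewrite mulr1.
- exact: itp_size.
- by rewrite size_poly1.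
move=> L f w nw; rewrite hev_itp => hn i c /andP [i0 iN] /co_par Hi.
have {}Hi := Hi (regular_iter i (regular_map cgh dgh f) nw).
apply: (H c (n - i)%N); first by rewrite subn_gt0 iN ltn_subrL i0.
have := co0_par (iter_par d (map_poly f g) (map_poly f h) (n - i) Hi).
rewrite -iterD subnK ?(ltnW iN) // => /(_ _ hn).
by rewrite iter_pt_map co_mapv => /eqP; rewrite fmorph_eq0 => /eqP.
Qed.

Definition orb x := exists a m, x = iter m Ph (pt F a).

Lemma orb_pt a : orb (pt F a). Proof. by exists a, 0%N. Qed.

Lemma orb_iter n x : orb x -> orb (iter n Ph x).
Proof. by case=> a [m ->]; exists a, (n + m)%N; rewrite iterD. Qed.

Lemma orb_nz x : orb x -> nz x.
Proof. by case=> a [m ->]; apply: regular_iter (regular_id cgh dgh) (nz_pt _ _). Qed.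

(* The form whose zeros are the preimages of c. *)
Definition fib c : {poly F} := c.2 *: g - c.1 *: h.

(** Total ramification at x. When 0 and oo are periodic, [fib_neq0] forces k to be nonzero, so that
    x is the only preimage of its image. *)
Definition tot_ram x := exists k : F, fib (Ph x) = k *: ell x ^+ d.

Lemma fib_size c : (size (fib c) <= d.+1)%N.
Proof.
rewrite /fib (leq_trans (size_polyD _ _)) // geq_max size_polyN.
by rewrite !(leq_trans (size_scale_leq _ _)).
Qed.

Lemma hev_fib (S : comNzRingType) (f : {rmorphism F -> S}) c w :
  hev d (map_poly f (fib c)) w =
  hev 1 (map_poly f (ell c)) (Phi d (map_poly f g) (map_poly f h) w).
Proof.
by rewrite hev_ell /fib rmorphB /= !map_polyZ -scaleN1r addrC hev_linear !hevZ /=; ring.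
Qed.

Lemma fib_par (L : fieldType) (f : {rmorphism F -> L}) c w : nz c -> nz w ->
  hev d (map_poly f (fib c)) w = 0 ->
  par (Phi d (map_poly f g) (map_poly f h) w) (mapv f c).
Proof.
move=> nc nw; rewrite hev_fib hev_ell => /eqP; rewrite subr_eq0 => /eqP e.
apply: det_par; first exact: (regular_map cgh dgh f nw).
  by move: nc; rewrite /nz /= !fmorph_eq0.
by rewrite /= [RHS]mulrC e mulrC.
Qed.

Lemma fib_par_id c w : nz c -> nz w -> hev d (fib c) w = 0 -> par (Ph w) c.
Proof.
move=> nc nw; have := @fib_par F idfun c w nc nw.
by rewrite !map_poly_id // /mapv; case: (c).
Qed.

Section Periodic.
Variable E : nat.
Hypothesis E0 : (0 < E)%N.
Hypothesis per : forall a, par (iter E Ph (pt F a)) (pt F a).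

Lemma orb_per x : orb x -> par (iter E Ph x) x.
Proof. by case=> a [m ->]; rewrite -iterD addnC iterD; apply: iter_par. Qed.

(** On the orbits f^(E-1) is a left inverse of f. *)
Lemma orb_inj x y : orb x -> orb y -> par (Ph x) (Ph y) -> par x y.
Proof.
move=> ox oy xy; apply: par_trans (par_sym (orb_per ox)) _.
apply: par_trans (orb_per oy); rewrite -(prednK E0) !iterSr; exact: iter_par.
Qed.

Lemma orb_iter_inj k x y : orb x -> orb y -> par (iter k Ph x) (iter k Ph y) -> par x y.
Proof.
move=> ox oy; elim: k => // k IH; rewrite !iterS => /orb_inj H.
by apply: IH; apply: H; apply: orb_iter.
Qed.

Lemma par_pt b c : par (pt F b) (pt F c) -> b = c.
Proof. by move/par_co/eqP; rewrite co_pt => /eqP. Qed.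

(** A zero fibre form would mean that 0 and oo both map to c, against injectivity on the orbits. *)
Lemma fib_neq0 c : nz c -> fib c != 0.
Proof.
move=> nc; apply/eqP => e.
have H a : par (Ph (pt F a)) c.
  by apply: fib_par_id (nz_pt _ _) _ => //; rewrite e hev0.
by have /par_pt := orb_inj (orb_pt true) (orb_pt false) (par_trans (H true) (par_sym (H false))).
Qed.

(** Removing from the fibre of c = f(x) the multiplicity m of x leaves a form [r] of degree N = d -
    m >= 1. Its zeros, pulled back by f^(n-t-1), qualify, and they number N d^(n-t-1). *)
Lemma not_tot_ram_bound x t n b : orb x -> ~ tot_ram x ->
  co b (iter t Ph (Ph x)) = 0 ->
  (forall s c, (s < t)%N -> co c (iter s Ph (Ph x)) <> 0) ->
  (t < n)%N -> Psi_ge g h n (d ^ (n - t.+1)).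
Proof.
move=> ox ntr ct tmin tn; set c := Ph x in ct tmin.
have nx := orb_nz ox; have nc : nz c := orb_nz (orb_iter 1 ox).
have [m [r [md sr er rx]]] := form_mult nx (fib_size c) (fib_neq0 nc).
(* For m = d the cofactor [r] would be constant and x totally ramified. *)
have {}md : (m < d)%N.
  rewrite ltn_neqAle md andbT; apply/eqP => em; apply: ntr; exists r`_0.
  by rewrite er em -mul_polyC mulrC -size1_polyC //; move: sr; rewrite em subnn.
set N := (d - m)%N in sr rx.
have dt0 : (0 < d ^ t)%N by rewrite expn_gt0 d0.
have [tau stau etau] : exists2 q : {poly F}, (size q <= (d ^ t).-1.+1)%N & co b (itp t) = ell c * q.
  apply: form_factor nc _ _; rewrite (prednK dt0) ?itp_size //.
  have := hev_itp g h d (@idfun F) t b c.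
  by rewrite !map_poly_id // ct.
have fibM (K : comNzRingType) (u : {rmorphism F -> K}) z :
    hev d (map_poly u (fib c)) z =
    hev 1 (map_poly u (ell x)) z ^+ m * hev N (map_poly u r) z.
  rewrite er rmorphM rmorphXn /=.
  have -> : d = (m * 1 + N)%N by rewrite muln1 subnKC // ltnW.
  have [s1 s2] := @hev_pow _ 1 m _ z (leq_trans (size_map_leq u _) (ell_size x)).
  by rewrite hevM // ?s2 // (leq_trans (size_map_leq u _)).
set k := (n - t.+1)%N.
have en : n = (t + k.+1)%N by rewrite addnS -addSn subnKC.
have Nk : (d ^ k <= N * d ^ k)%N by rewrite leq_pmull // subn_gt0.
apply: Psi_ge_le Nk _.
(* With n = t + k + 1, coordinate b of f^(n) is [ell c] times [tau], both composed with f^(k+1). In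
   it [ell c] composed with f is [fib c], that is, [ell x] to the power m times [r]. This gives the
   factors R, S1^m and S2. *)
pose R := hcomp N r (itp k).1 (itp k).2.
pose S1 := hcomp 1 (ell x) (itp k).1 (itp k).2.
pose S2 := hcomp (d ^ t).-1 tau (itp k.+1).1 (itp k.+1).2.
have sR : (size R <= (N * d ^ k).+1)%N.
  by apply: hcomp_size; [exact: (itp_size _ _ _ _ false)|exact: (itp_size _ _ _ _ true)].
have sS1 : (size S1 <= (d ^ k).+1)%N.
  by rewrite -[X in X.+1]mul1n; apply: hcomp_size; [exact: (itp_size _ _ _ _ false)|exact: (itp_size _ _ _ _ true)].
have sS2 : (size S2 <= ((d ^ t).-1 * d ^ k.+1).+1)%N.
  by apply: hcomp_size; [exact: (itp_size _ _ _ _ false)|exact: (itp_size _ _ _ _ true)].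
have eD : (d ^ n = N * d ^ k + (m * d ^ k + (d ^ t).-1 * d ^ k.+1))%N.
  rewrite en expnD addnA -mulnDl subnK ?(ltnW md) // -expnS -mulSn.
  by rewrite (prednK dt0).
apply: (@degree_bound _ g h d cgh dgh d0 n b R (S1 ^+ m * S2)) => //.
- by rewrite (leq_trans _ tn).
- rewrite en itp_add etau -(prednK dt0) -add1n /hcomp rmorphM /=.
  have smap (q : {poly F}) M : (size q <= M)%N -> (size (map_poly polyC q) <= M)%N by rewrite size_map_polyC.
  have eS2 : hev (d ^ t).-1 (map_poly polyC tau)
      (Phi d (map_poly polyC g) (map_poly polyC h) (itp k)) = S2 by [].
  rewrite -[(hev d _ _, hev d _ _)]/(Phi d (map_poly polyC g) (map_poly polyC h) (itp k)).
  rewrite hevM ?smap ?ell_size // eS2 mulrA; congr (_ * _).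
  by rewrite -hev_fib fibM mulrC /R /S1 /hcomp -!surjective_pairing.
- by rewrite eD leq_addr.
- rewrite eD addKn; apply: size_formM => //.
  exact: (@hev_pow _ _ m _ (0, 0) sS1).1.
move=> L f w nw; rewrite hev_hcomp; last 2 first.
- exact: (itp_size _ _ _ _ false).
- exact: (itp_size _ _ _ _ true).
rewrite (hev_itp _ _ _ _ _ false) (hev_itp _ _ _ _ _ true) -surjective_pairing.
set Phf := Phi d _ _; set Z := iter k Phf w => rZ i c' /andP [i0 iN] ci.
have nzi j : nz (iter j Phf w) by apply: regular_iter (regular_map cgh dgh f) nw.
have fibZ (K : fieldType) (u : {rmorphism F -> K}) z :
    hev N (map_poly u r) z = 0 -> hev d (map_poly u (fib c)) z = 0.
  by move=> rz; rewrite fibM rz mulr0.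
(* A visit to {0, oo} up to time k puts f^(k)(w) on the orbits, where injectivity identifies it with
   x; but [r] does not vanish at x. *)
have [ik|ki] := leqP i k.
  have Hp := iter_par d (map_poly f g) (map_poly f h) (k - i) (co_par (nzi i) ci).
  rewrite -iterD subnK // iter_pt_map in Hp.
  have := hev_par Hp rZ; rewrite hev_map => /eqP; rewrite fmorph_eq0 => /eqP ry.
  have oy := orb_iter (k - i) (orb_pt c').
  have fy := fibZ F idfun (iter (k - i) Ph (pt F c')); rewrite !map_poly_id // in fy.
  have pxy := orb_inj oy ox (fib_par_id nc (orb_nz oy) (fy ry)).
  by move/eqP: rx; apply; apply: hev_par pxy ry.
(* From time k + 1 on, w follows the orbit of c, which avoids {0, oo} before time t. *)
have Hp := iter_par d (map_poly f g) (map_poly f h) (i - k.+1) (fib_par nc (nzi k) (fibZ _ _ _ rZ)).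
rewrite -[Phi _ _ _ _]/(iter k.+1 Phf w) -iterD subnK // iter_Phi_map in Hp.
have := co0_par Hp ci; rewrite co_mapv => /eqP; rewrite fmorph_eq0 => /eqP.
by apply: tmin; rewrite ltn_subLR // addnC -en.
Qed.
End Periodic.
End Dynamics.

(** * Total ramification at three points and powers of p *)

(** Write d = q m with q the p-part of d. As X -> X^q is compatible with adding 1, the identity
    descends from d to m; its linear coefficient would make m zero in F if m > 1. *)
Lemma binomial_frobenius (F : fieldType) d : (2 <= d)%N ->
  ('X + 1 : {poly F}) ^+ d = 'X^d + 1 ->
  exists p l, [/\ p \in [pchar F], (1 <= l)%N & d = (p ^ l)%N].
Proof.
move=> d2 e; have dgt0 : (0 < d)%N by apply: leq_trans d2.
(* Derivatives at 0 are compared; the right-hand side is 0 for m > 1 and 1 for m = 1. *)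
have linear_coef m : (0 < m)%N -> ('X + 1 : {poly F}) ^+ m = 'X^m + 1 ->
    (m%:R : F) = 0 ^+ m.-1 *+ m.
  move=> m0 /(congr1 (fun q : {poly F} => (q^`()).[0])).
  rewrite deriv_exp derivD derivX derivD derivXn -polyC1 derivC !addr0 polyC1 mul1r.
  by rewrite !hornerMn !hornerE /= expr1n => ->.
have dF : (d%:R : F) == 0.
  by rewrite (linear_coef d dgt0 e) expr0n; case: (d) d2 => [|[]] //= n _; rewrite mul0rn.
have [p cp] := natf0_pchar dgt0 dF.
have pp := pcharf_prime cp.
set q := (d`_p)%N; set m := (d`_p^')%N.
have dqm : (d = q * m)%N by rewrite partnC.
have q0 : (0 < q)%N by rewrite part_gt0.
have m0 : (0 < m)%N by rewrite part_gt0.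
have frobq : ('X + 1 : {poly F}) ^+ q = 'X^q + 1.
  rewrite exprDn_pchar ?expr1n // (eq_pnat _ (pchar_poly F)) (eq_pnat _ (pcharf_eq cp)).
  exact: part_pnat.
have em : ('X + 1 : {poly F}) ^+ m = 'X^m + 1.
  apply/eqP; rewrite -subr_eq0 -(@comp_poly_eq0 _ _ 'X^q) ?size_polyXn ?ltnS //.
  rewrite comp_polyB comp_polyD -polyC1 !comp_polyC comp_Xn_poly polyC1.
  rewrite rmorphXn /= comp_polyD comp_polyX -polyC1 comp_polyC polyC1.
  by rewrite -frobq -exprM -exprM -dqm e subrr.
have mF : (m%:R : F) != 0.
  by rewrite -(dvdn_pcharf cp) -p'natE // part_pnat.
have m1 : m = 1%N.
  have := linear_coef m m0 em; rewrite expr0n; case: (m) mF m0 => [|[|k]] //= + _ e2.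
  by rewrite e2 mul0rn eqxx.
exists p, (logn p d); rewrite -p_part -/q {2}dqm m1 muln1; split=> //.
by rewrite logn_gt0 mem_primes pp dgt0 (dvdn_pcharf cp) dF.
Qed.

Section Ramification.
Variables (F : fieldType) (g h : {poly F}) (d : nat).
Hypothesis cgh : coprimep g h.
Hypothesis dgh : maxn (size g) (size h) = d.+1.
Hypothesis d2 : (2 <= d)%N.
Notation Ph := (Phi d g h).

Let d0 : (0 < d)%N. Proof. exact: leq_trans d2. Qed.

Lemma tot_ram_infty : tot_ram g h d (pt F true) ->
  (size (fib g h (Ph (pt F true))) <= 1)%N.
Proof.
case=> k ->; rewrite /ell /= scale0r sub0r -polyCN -rmorphXn /= -mul_polyC -polyCM.
exact: size_polyC_leq1.
Qed.

Lemma tot_ram_zero : tot_ram g h d (pt F false) ->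
  exists k, fib g h (Ph (pt F false)) = k *: 'X^d.
Proof. by case=> k ->; exists k; rewrite /ell /= scale1r subr0. Qed.

Lemma Phi_infty : Ph (pt F true) = (g`_d, h`_d).
Proof. by rewrite /Phi /= !hev_infty. Qed.

Lemma Phi_zero : Ph (pt F false) = (g`_0, h`_0).
Proof.
by rewrite /Phi /= !hev_affine ?horner_coef0 // -dgh ?leq_maxl ?leq_maxr.
Qed.

Definition in_span (q : {poly F}) := exists x y : F, q = x *: 'X^d + y%:P.

Lemma in_span_comb (s t : F) p q : in_span p -> in_span q -> in_span (s *: p - t *: q).
Proof.
case=> x [y ->] [x' [y' ->]]; exists (s * x - t * x'), (s * y - t * y').
by rewrite -!mul_polyC !polyCB !polyCM; ring.
Qed.

Lemma in_spanZ (s : F) q : s != 0 -> in_span (s *: q) -> in_span q.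
Proof.
move=> s0 H; have := in_span_comb s^-1 0 H H.
by rewrite scale0r subr0 scalerA mulVf // scale1r.
Qed.

Lemma in_span_comp q : in_span q ->
  exists2 a : {poly F}, (size a <= 2)%N & q = a \Po 'X^d.
Proof.
case=> x [y ->]; exists (x *: 'X + y%:P).
  rewrite (leq_trans (size_polyD _ _)) // geq_max (leq_trans (size_scale_leq _ _)) ?size_polyX //.
  exact: leq_trans (size_polyC_leq1 _) _.
by rewrite comp_polyD comp_polyZ comp_polyX comp_polyC.
Qed.

Lemma in_span_linear_power (w : F * F) : w.1 != 0 -> w.2 != 0 ->
  in_span (ell w ^+ d) -> ('X + 1 : {poly F}) ^+ d = 'X^d + 1.
Proof.
move=> w1 w2 [x [y e]].
have : in_span ((- w.1) ^+ d *: ('X + 1) ^+ d).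
  (* The substitution X -> -(w.1 / w.2) X turns [ell w] into -w.1 (X + 1) and preserves the span of
     X^d and 1. *)
  exists (x * (- (w.1 / w.2)) ^+ d), y.
  have := congr1 (comp_poly (- (w.1 / w.2) *: 'X)) e.
  rewrite rmorphXn /= /ell comp_polyB comp_polyD !comp_polyZ comp_polyX !comp_polyC comp_Xn_poly.
  rewrite !exprZn -!scalerA => <-; rewrite -exprZn; congr (_ ^+ _).
  rewrite scalerA mulrN mulrC divfK // scalerDr; congr (_ + _).
  by rewrite -mul_polyC mulr1 polyCN.
move=> /in_spanZ [|x' [y' {}e]]; first by rewrite expf_neq0 // oppr_eq0.
have y1 : y' = 1.
  have := congr1 (fun q : {poly F} => q.[0]) e.
  by rewrite !hornerE /= expr1n expr0n; case: (d) d0 => //= n _; rewrite mulr0 add0r.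
have mon : ('X + 1 : {poly F}) ^+ d \is monic.
  by rewrite -[1]opprK -polyC1 -polyCN monic_exp // monicXsubC.
have x1 : x' = 1.
  have sd : size (('X + 1 : {poly F}) ^+ d) = d.+1.
    by rewrite -[1]opprK -polyC1 -polyCN size_exp_XsubC.
  have := monicP mon; rewrite lead_coefE sd /= e coefD coefZ coefXn eqxx mulr1 coefC.
  by case: (d) d0 => //= n _; rewrite addr0.
by rewrite e x1 y1 scale1r.
Qed.

(** The fibre forms over f(0) and f(oo) are multiples of X^d and of 1. These two images are distinct
    points, so Cramer's rule puts [g] and [h] in the span of X^d and 1. The fibre form through w
    then lies there too, and it is a multiple of the d-th power of [ell w]. *)
Lemma tot_ram_frobenius E w : (0 < E)%N ->
  (forall a, par (iter E Ph (pt F a)) (pt F a)) ->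
  w.1 != 0 -> w.2 != 0 ->
  tot_ram g h d (pt F false) -> tot_ram g h d (pt F true) -> tot_ram g h d w ->
  exists (a b : {poly F}) (p l : nat),
    [/\ g = a \Po 'X^d, h = b \Po 'X^d, (size a <= 2)%N, (size b <= 2)%N &
        [/\ p \in [pchar F], (1 <= l)%N & d = (p ^ l)%N]].
Proof.
move=> E0 per w1 w2 /tot_ram_zero [k0 e0] /tot_ram_infty /size1_polyC e1 [k2 e2].
set u := Ph (pt F false) in e0; set v := Ph (pt F true) in e1.
set D := u.1 * v.2 - u.2 * v.1.
have D0 : D != 0.
  rewrite subr_eq0; apply/eqP => eD.
  have nzP a : nz (Ph (pt F a)) := regular_id cgh dgh (nz_pt F a).
  have puv : par u v by apply: det_par; rewrite ?nzP.
  have := orb_inj E0 per (orb_pt _ _ _ false) (orb_pt _ _ _ true) puv.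
  by move/par_pt.
have su : in_span (fib g h u) by rewrite e0; exists k0, 0; rewrite addr0.
have sv : in_span (fib g h v) by rewrite e1; exists 0, (fib g h v)`_0; rewrite scale0r add0r.
have sg : in_span g.
  apply: (in_spanZ D0).
  suff -> : D *: g = u.1 *: fib g h v - v.1 *: fib g h u by exact: in_span_comb.
  by rewrite /fib /D -!mul_polyC !polyCB !polyCM; ring.
have sh : in_span h.
  apply: (in_spanZ D0).
  suff -> : D *: h = u.2 *: fib g h v - v.2 *: fib g h u by exact: in_span_comb.
  by rewrite /fib /D -!mul_polyC !polyCB !polyCM; ring.
have nw : nz w by rewrite /nz w1.
have k20 : k2 != 0.
  apply: contraTneq (fib_neq0 cgh dgh E0 per (regular_id cgh dgh nw)) => k20.
  by rewrite e2 k20 scale0r eqxx.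
have sw : in_span (ell w ^+ d) by apply: (in_spanZ k20); rewrite -e2; exact: in_span_comb.
have [p [l [cp l1 dp]]] := binomial_frobenius d2 (in_span_linear_power w1 w2 sw).
have [a sa ea] := in_span_comp sg; have [b sb eb] := in_span_comp sh.
by exists a, b, p, l.
Qed.
End Ramification.

(** * Visits of the orbits to 0 and infinity *)

Section Visits.
Variables (F : fieldType) (g h : {poly F}) (d : nat).
Hypothesis cgh : coprimep g h.
Hypothesis dgh : maxn (size g) (size h) = d.+1.
Hypothesis d0 : (0 < d)%N.
Notation Ph := (Phi d g h).
Notation orb := (orb g h d).
Notation tot_ram := (tot_ram g h d).

Definition at_0_or_infty (x : F * F) := [exists b : bool, co b x == 0].

Lemma at_0_or_inftyP x :
  reflect (exists b : bool, co b x = 0) (at_0_or_infty x).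
Proof. by apply: (iffP existsP) => -[b /eqP e]; exists b; rewrite ?e. Qed.

Lemma at_0_or_infty_par x y : par x y -> at_0_or_infty x -> at_0_or_infty y.
Proof. by move=> xy /at_0_or_inftyP [b /(co0_par xy) e]; apply/at_0_or_inftyP; exists b. Qed.

Lemma iter_pt_nz n a : nz (iter n Ph (pt F a)).
Proof. exact: regular_iter (regular_id cgh dgh) (nz_pt F a). Qed.

(** Restarting from 0 or oo at each return, visits are never more than j steps apart. *)
Lemma recurrent_visits j :
  (forall a, exists2 T, (0 < T <= j)%N & at_0_or_infty (iter T Ph (pt F a))) ->
  forall m a, exists2 r, (r < j)%N & at_0_or_infty (iter (r + m.+1) Ph (pt F a)).
Proof.
move=> HT m; elim/ltn_ind: m => m IH a.
have [T /andP [T0 Tj] vT] := HT a.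
have [mT|Tm] := ltnP m T.
  by exists (T - m.+1)%N; [rewrite ltn_subLR //; lia | rewrite subnK].
have /at_0_or_inftyP [c /(co_par (iter_pt_nz T a)) pc] := vT.
have [|r rj vr] := IH (m - T)%N _ c; first by rewrite ltn_subrL T0 (leq_trans T0 Tm).
exists r => //; have -> : (r + m.+1 = (r + (m - T).+1) + T)%N by lia.
by rewrite iterD; apply: at_0_or_infty_par vr; apply/par_sym/iter_par.
Qed.

Lemma exists_not_tot_ram : ~ (forall x, orb x -> tot_ram x) ->
  exists2 x, orb x & ~ tot_ram x.
Proof.
move=> H; apply: NNPP => H2; apply: H => x ox.
by apply: NNPP => nt; apply: H2; exists x.
Qed.

(** By [recurrent_visits] the image of a point that is not totally ramified first meets {0, oo} at
    some time t < j, and n - (t + 1) >= n - j. *)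
Lemma periodic_bound E j n :
  (0 < E)%N -> (forall a, par (iter E Ph (pt F a)) (pt F a)) ->
  ~ (forall x, orb x -> tot_ram x) ->
  (forall a, exists2 T, (0 < T <= j)%N & at_0_or_infty (iter T Ph (pt F a))) ->
  (j < n)%N -> Psi_ge g h n (d ^ (n - j)).
Proof.
move=> E0 per /exists_not_tot_ram [x ox nx] HT jn.
have exr : exists r, at_0_or_infty (iter r Ph (Ph x)) && (r < j)%N.
  have [a [m ->]] := ox; have [r rj vr] := recurrent_visits HT m a.
  by exists r; rewrite rj andbT -iterS -iterD.
case: (ex_minnP exr) => t /andP [/at_0_or_inftyP [b tb] tj] tmin.
apply: (@Psi_ge_le _ _ _ _ (d ^ (n - t.+1))); first by rewrite leq_pexp2l // leq_sub2l.
apply: (@not_tot_ram_bound _ _ _ _ cgh dgh d0 E E0 per x t n b) => //; last exact: leq_ltn_trans (ltnW tj) jn.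
move=> s c st sc; have := tmin s; rewrite (ltn_trans st tj) leqNgt st andbT.
by move=> H; apply: notF; apply: H; apply/at_0_or_inftyP; exists c.
Qed.

Definition reaches a b := exists2 s, (0 < s)%N & par (iter s Ph (pt F a)) (pt F b).

Lemma reaches_trans b a c : reaches a b -> reaches b c -> reaches a c.
Proof.
case=> s s0 ps [t t0 qt]; exists (t + s)%N; first by rewrite addn_gt0 t0.
by rewrite iterD; apply: par_trans qt; apply: iter_par.
Qed.

(** If both points are reached from {0, oo}, going back twice from b meets a repetition among the
    two points, so b reaches itself; E is the product of the two return times. *)
Lemma unreached_or_periodic :
  (exists b, forall a, ~ reaches a b) \/
  (exists2 E, (0 < E)%N & forall a, par (iter E Ph (pt F a)) (pt F a)).
Proof.
case: (classic (exists b, forall a, ~ reaches a b)) => H; [by left | right].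
have {}H b : exists a, reaches a b.
  by apply: NNPP => Hb; apply: H; exists b => a rab; apply: Hb; exists a.
have self b : reaches b b.
  have [a rab] := H b; have [c rca] := H a.
  have [eab|ab] := eqVneq a b; first by rewrite -{1}eab.
  have [cb|cb] := eqVneq c b; first by rewrite cb in rca; apply: reaches_trans rca rab.
  (* Here a is periodic with period t and b = f^(s)(a), so b has period t as well. *)
  have ca : c = a by move: ab cb; case: (a); case: (b); case: (c).
  rewrite {c cb}ca in rca; have [s s0 ps] := rab; have [t t0 qt] := rca.
  exists t => //; apply: par_trans (iter_par d g h t (par_sym ps)) _.
  rewrite -iterD addnC iterD; apply: par_trans ps; exact: iter_par.
have [s s0 ps] := self true; have [t t0 qt] := self false.
have rep n a k : par (iter n Ph (pt F a)) (pt F a) -> par (iter (k * n) Ph (pt F a)) (pt F a).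
  move=> p; elim: k => [|k IH]; first exact: par_refl.
  by rewrite mulSn iterD; apply: par_trans p; apply: iter_par.
by exists (t * s)%N; [rewrite muln_gt0 t0 | case; [apply: rep | rewrite mulnC; apply: rep]].
Qed.

Lemma unreached_bound b n : (0 < n)%N -> (forall a, ~ reaches a b) ->
  Psi_ge g h n (d ^ n).
Proof.
move=> n0 H; apply: (not_reached_bound cgh dgh d0 (b := b)) => // a s /andP [s0 _] e.
by case: (H a); exists s => //; apply: co_par (iter_pt_nz s a) e.
Qed.

Lemma fiter_zero n : is_zero_of (fiter g h n) 0 <-> co false (iter n Ph (pt F false)) = 0.
Proof.
have E : (itp g h d n).1.[0] = co false (iter n Ph (pt F false)).
  have := itp_horner g h d (@idfun F) n false 0.
  by rewrite !map_poly_id.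
rewrite (fiterE cgh dgh d0); split=> [[a [b [b0 cab eab ra]]]|e]; last first.
  exists (itp g h d n).1, (itp g h d n).2; split=> //.
  - exact: (itp_neq0 cgh dgh d0 n true).
  - exact: (itp_coprime cgh dgh n false).
  - by rewrite rootE E e.
have := rfun_eq (itp_neq0 cgh dgh d0 n true) b0 eab.
move=> /(congr1 (fun q : {poly F} => q.[0])); rewrite !hornerM E (rootP ra) mulr0.
by move/eqP; rewrite mulf_eq0 (negPf (coprimep_root cab ra)) orbF => /eqP.
Qed.

(* With j the longest first return time, the end b of the corresponding excursion
   is not met before time j: by injectivity on the cycles, an earlier visit of b
   would be the end of that same excursion. *)
Lemma longest_return E :
  (0 < E)%N -> (forall a, par (iter E Ph (pt F a)) (pt F a)) ->
  exists j b,
    (forall a, exists2 T, (0 < T <= j)%N & at_0_or_infty (iter T Ph (pt F a))) /\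
    (forall a s, (0 < s < j)%N -> co b (iter s Ph (pt F a)) <> 0).
Proof.
move=> E0 per.
have ret a : exists T, [/\ (0 < T)%N, at_0_or_infty (iter T Ph (pt F a)) &
    forall s, (0 < s < T)%N -> ~~ at_0_or_infty (iter s Ph (pt F a))].
  have exT : exists T, (0 < T)%N && at_0_or_infty (iter T Ph (pt F a)).
    by exists E; rewrite E0; apply/at_0_or_inftyP; exists a; apply: par_co.
  case: (ex_minnP exT) => T /andP [T0 vT] Tmin; exists T; split=> // s /andP [s0 sT].
  by apply/negP => vs; have := Tmin s; rewrite s0 vs leqNgt sT => /(_ isT).
have [Tt [Tt0 vt mt]] := ret true; have [Tf [Tf0 vf mf]] := ret false.
have [j [a [ja va ma Hj]]] : exists j a, [/\ (0 < j)%N, at_0_or_infty (iter j Ph (pt F a)),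
    forall s, (0 < s < j)%N -> ~~ at_0_or_infty (iter s Ph (pt F a)) &
    (Tt <= j)%N /\ (Tf <= j)%N].
  by case: (leqP Tt Tf) => H; [exists Tf, false | exists Tt, true]; split=> //; split=> //; apply: ltnW.
have /at_0_or_inftyP [b /(co_par (iter_pt_nz j a)) pb] := va.
exists j, b; split.
  by case: Hj => H1 H2; case; [exists Tt | exists Tf]; rewrite ?Tt0 ?Tf0.
move=> a' s /andP [s0 sj] /(co_par (iter_pt_nz s a')) ps.
have : par (pt F a') (iter (j - s) Ph (pt F a)).
  apply: (@orb_iter_inj _ _ _ _ E E0 per s); [exact: orb_pt | exact/orb_iter/orb_pt |].
  by rewrite -iterD subnKC ?(ltnW sj) //; apply: par_trans (par_sym pb).
move/par_sym/par_co => e.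
have := ma (j - s)%N; rewrite subn_gt0 sj ltn_subrL s0 ja => /(_ isT) /at_0_or_inftyP; apply.
by exists a'.
Qed.
End Visits.

(** * Recognizing the excluded shapes of f *)

Section Exceptional.
Variable F : fieldType.
Implicit Types (a b g h u v : {poly F}).

Lemma rfun_eqI a b u v : b != 0 -> v != 0 -> a * v = b * u -> rfun a b = rfun u v.
Proof.
move=> b0 v0 e; apply/eqP; rewrite /rfun eqr_div ?pfrac_eq0 // /pfrac -!tofracM tofrac_eq.
by rewrite e mulrC.
Qed.

Lemma monomial_pos (k c : F) d : k != 0 -> c != 0 -> is_monomial (k *: 'X^d) c%:P.
Proof.
move=> k0 c0; exists (k / c), d%:Z; split; first by rewrite mulf_neq0 ?invr_eq0.
transitivity (rfun ((k / c) *: 'X^d) 1); last first.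
  by rewrite /rfun /cfrac /Xf /pfrac -mul_polyC tofracM tofracXn tofrac1 divr1.
apply: rfun_eqI; rewrite ?polyC_eq0 ?oner_eq0 // mulr1 mul_polyC scalerA.
by rewrite mulrC divfK.
Qed.

Lemma monomial_neg (k c : F) d : k != 0 -> c != 0 -> is_monomial c%:P (k *: 'X^d).
Proof.
move=> k0 c0; exists (c / k), (- d%:Z); split; first by rewrite mulf_neq0 ?invr_eq0.
transitivity (rfun (c / k)%:P 'X^d); last first.
  by rewrite /rfun /cfrac /Xf /pfrac tofracXn -exprnN.
have Xd0 : 'X^d != 0 :> {poly F} by rewrite -size_poly_eq0 size_polyXn.
apply: rfun_eqI; rewrite ?scaler_eq0 ?negb_or ?k0 //.
by rewrite -[k *: _]mul_polyC [RHS]mulrAC -polyCM [k * _]mulrC divfK.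
Qed.

Lemma linear_comp a d : (size a <= 2)%N -> a \Po 'X^d = a`_1 *: 'X^d + (a`_0)%:P.
Proof.
move=> sa; rewrite {1}(poly_wide sa) !big_ord_recr big_ord0 /= add0r.
by rewrite comp_polyD !comp_polyZ !comp_Xn_poly expr0 expr1 addrC alg_polyC.
Qed.

Lemma binomial_pbinomial a (c : F) p l : (size a <= 2)%N -> a`_1 != 0 -> c != 0 ->
  p \in [pchar F] -> is_pbinomial (a \Po 'X^(p ^ l)) c%:P.
Proof.
move=> sa a1 c0 cp; exists p, (a`_1 / c), (a`_0 / c), l; split=> //.
  by rewrite mulf_neq0 ?invr_eq0.
transitivity (rfun ((a`_1 / c) *: 'X^(p ^ l) + (a`_0 / c)%:P) 1); last first.
  by rewrite /rfun /cfrac /Xf /pfrac -mul_polyC tofracD tofracM tofracXn tofrac1 divr1.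
apply: rfun_eqI; rewrite ?polyC_eq0 ?oner_eq0 // mulr1 linear_comp //.
by rewrite -!mul_polyC mulrDr mulrA -!polyCM ![c * _]mulrC !divfK.
Qed.

(** Composing gcd(a, b) with X^(p^l) gives a divisor of gcd(g, h), so [a] and [b] are coprime;
    degrees are divided by p^l. *)
Lemma frobenius_factor g h a b p l :
  g = a \Po 'X^(p ^ l) -> h = b \Po 'X^(p ^ l) -> h != 0 ->
  coprimep g h -> maxn (pdeg g) (pdeg h) = (p ^ l)%N -> (1 < p ^ l)%N ->
  p \in [pchar F] -> (1 <= l)%N -> is_L_of_frob g h.
Proof.
move=> eg eh h0 cgh dgh q1 cp l1.
have pdc (c : {poly F}) : pdeg (c \Po 'X^(p ^ l)) = (pdeg c * p ^ l)%N.
  by rewrite /pdeg size_comp_poly size_polyXn.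
exists a, b, p, l; split=> //; first split.
- by apply: contraNneq h0 => b0; rewrite eh b0 comp_poly0.
- have b0 : b != 0 by apply: contraNneq h0 => b0; rewrite eh b0 comp_poly0.
  have c0 : gcdp a b != 0 by rewrite gcdp_eq0 negb_and b0 orbT.
  have : gcdp a b \Po 'X^(p ^ l) %| gcdp g h.
    by rewrite eg eh dvdp_gcd !dvdp_comp_poly ?dvdp_gcdl ?dvdp_gcdr.
  have ghn0 : gcdp g h != 0 by rewrite gcdp_eq0 negb_and h0 orbT.
  move/(dvdp_leq ghn0); rewrite (eqP cgh) => sc.
  have := pdc (gcdp a b); rewrite {1}/pdeg (_ : (size _).-1 = 0%N); last first.
    by case: (size _) sc => [|[]].
  move/esym/eqP; rewrite muln_eq0 (gtn_eqF (ltnW q1)) orbF /pdeg /coprimep.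
  by move: c0; rewrite -size_poly_gt0; case: (size _) => [|[]].
- by move: dgh; rewrite eg eh !pdc -maxnMl -[RHS]mul1n => /eqP; rewrite eqn_pmul2r ?(ltnW q1) // => /eqP.
have pev c : peval c (Xf F ^+ (p ^ l)) = pfrac (c \Po 'X^(p ^ l)).
  rewrite pevalE map_poly_comp /= /Xf /pfrac -tofracXn horner_map /=.
  by rewrite /comp_poly.
by rewrite /rcomp !pev eg eh.
Qed.

Lemma frobenius_inseparable a b p l : p \in [pchar F] -> (1 <= l)%N ->
  ~ separable_rf (a \Po 'X^(p ^ l)) (b \Po 'X^(p ^ l)).
Proof.
move=> cp l1; have dX : ('X^(p ^ l) : {poly F})^`() = 0.
  by rewrite derivXn -scaler_nat natrX (pcharf0 cp) expr0n eqn0Ngt l1 scale0r.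
by rewrite /separable_rf !deriv_comp dX !mulr0 mul0r subrr eqxx.
Qed.
End Exceptional.

(** * The three cases of the theorem *)

Section Cases.
Variables (F : fieldType) (g h : {poly F}) (d : nat).
Hypothesis cgh : coprimep g h.
Hypothesis dgh : maxn (size g) (size h) = d.+1.
Hypothesis d2 : (2 <= d)%N.
Hypothesis h0 : h != 0.
Hypothesis nmon : ~ is_monomial g h.
Notation Ph := (Phi d g h).
Notation tot_ram := (tot_ram g h d).

Let d0 : (0 < d)%N. Proof. exact: leq_trans d2. Qed.

(** This makes f(0) a third point. If f(0) were 0 or oo, then [g] or [h] would be a multiple of X^d,
    and with the other one constant f would be a monomial. *)
Lemma tot_ram_zero_image : tot_ram (pt F false) ->
  ((size g <= 1)%N \/ (size h <= 1)%N) ->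
  g`_0 != 0 /\ h`_0 != 0.
Proof.
case/tot_ram_zero => k; rewrite Phi_zero //= /fib /= => e sgh.
have szX c : size (c *: 'X^d : {poly F}) != 1%N.
  have [->|c0] := eqVneq c 0; first by rewrite scale0r size_poly0.
  by rewrite size_scale // size_polyXn; case: (d) d0.
have gh0 : (g`_0 != 0) || (h`_0 != 0).
  by have := regular_id cgh dgh (nz_pt F false); rewrite /nz Phi_zero.
split; apply/eqP => z.
  rewrite z eqxx /= in gh0; rewrite z scale0r subr0 in e.
  have eg : g = ((h`_0)^-1 * k) *: 'X^d by rewrite -scalerA -e scalerA mulVf // scale1r.
  have [sg|sh] := sgh.
    have g00 : g = 0 by rewrite [g]size1_polyC // z.
    have := cgh; rewrite g00 coprime0p => /eqp_size; rewrite size_poly1 => sh.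
    by have := dgh; rewrite g00 size_poly0 sh max0n => -[e0]; have := d2; rewrite -e0.
  have g0 : g != 0.
    apply/eqP => g00; have := dgh; rewrite g00 size_poly0 max0n => sd.
    by move: sh; rewrite sd; have := d2; case: (d).
  apply: nmon; rewrite [h]size1_polyC // eg; apply: monomial_pos; last by [].
  by apply: contraNneq g0 => e0; rewrite eg e0 scale0r.
rewrite z eqxx orbF in gh0; rewrite z scale0r sub0r in e.
have eh : h = (- ((g`_0)^-1 * k)) *: 'X^d.
  by rewrite scaleNr -scalerA -e scalerN scalerA mulVf // scale1r opprK.
have [/size1_polyC sg|sh] := sgh; last first.
  by have := h0; rewrite [h]size1_polyC // z eqxx.
apply: nmon; rewrite sg eh; apply: monomial_neg; last by [].
by apply: contraNneq h0 => e0; rewrite eh e0 scale0r.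
Qed.

(** The shape given by [tot_ram_frobenius] is both inseparable and of the form L(X^(p^l)), so either
    alternative refutes it. *)
Lemma some_not_tot_ram w E : (0 < E)%N ->
  (forall a, par (iter E Ph (pt F a)) (pt F a)) ->
  orb g h d w -> w.1 != 0 -> w.2 != 0 ->
  (separable_rf g h \/ ~ is_L_of_frob g h) ->
  ~ (forall x, orb g h d x -> tot_ram x).
Proof.
move=> E0 per ow w1 w2 nL H.
have [a [b [p [l [eg eh _ _ [cp l1 dp]]]]]] :=
  tot_ram_frobenius cgh dgh d2 E0 per w1 w2 (H _ (orb_pt _ _ _ false)) (H _ (orb_pt _ _ _ true)) (H w ow).
case: nL => [|[]]; first by rewrite eg eh dp; apply: frobenius_inseparable.
apply: (frobenius_factor (a := a) (b := b) (p := p) (l := l)) => //; rewrite -?dp //.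
by have := dgh; have := d2; rewrite /pdeg; lia.
Qed.

(** Infinity is fixed, so 0 can only be reached from 0. If f^(e)(0) = 0, both points have period e,
    and total ramification along the orbits would make f a monomial or a binomial in X^(p^l). *)
Lemma polynomial_case n : (size h <= 1)%N -> ~ is_pbinomial g h -> (1 <= n)%N ->
  ((forall k, (0 < k < n)%N -> ~ is_zero_of (fiter g h k) 0) -> Psi_ge g h n (d ^ n)) /\
  (forall e : nat, (0 < e < n)%N -> is_zero_of (fiter g h e) 0 -> Psi_ge g h n (d ^ (n - e))).
Proof.
move=> sh nbin n1.
have hd : h`_d = 0 by rewrite nth_default // (leq_trans sh).
have inf s : par (iter s Ph (pt F true)) (pt F true).
  elim: s => [|s IH]; first exact: par_refl.
  rewrite iterSr; apply: par_trans IH; apply: iter_par.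
  by apply: co_par; [exact: regular_id cgh dgh _ (nz_pt F true) | rewrite Phi_infty].
split=> [H|e /andP [e0 en] ze].
  apply: (not_reached_bound cgh dgh d0 (b := false)) => // -[] s sn e.
    by have := co0_par (inf s) e => /= /eqP; rewrite oner_eq0.
  by apply: (H s sn); apply/(fiter_zero cgh dgh d0).
have per a : par (iter e Ph (pt F a)) (pt F a).
  case: a => //; apply: co_par (iter_pt_nz cgh dgh e false) _.
  by apply/(fiter_zero cgh dgh d0).
apply: (periodic_bound cgh dgh d0 e0 per) => //; last first.
  by move=> a; exists e; rewrite ?e0 ?leqnn //; apply/at_0_or_inftyP; exists a; apply: par_co.
move=> H; have [g00 h00] := tot_ram_zero_image (H _ (orb_pt _ _ _ false)) (or_intror sh).
have ow : orb g h d (g`_0, h`_0) by rewrite -(Phi_zero dgh); exact: (orb_iter 1 (orb_pt g h d false)).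
have [a [b [p [l [eg eh sa _ [cp l1 dp]]]]]] :=
  tot_ram_frobenius cgh dgh d2 e0 per (w := (g`_0, h`_0)) g00 h00 (H _ (orb_pt _ _ _ false)) (H _ (orb_pt _ _ _ true)) (H _ ow).
apply: nbin; rewrite [h]size1_polyC // eg dp; apply: binomial_pbinomial => //.
(* Were this coefficient zero, [g] would be constant like [h], against d >= 2. *)
apply/eqP => a1; have := dgh; rewrite eg linear_comp // a1 scale0r add0r.
by have := d2; have := size_polyC_leq1 a`_0; move: sh; lia.
Qed.

(** Infinity maps into {0, oo} at once, so t = 0. It is not totally ramified, since the fibre form
    over its image is a nonzero multiple of [h] or [g], which is not constant. *)
Lemma unequal_degree_case n : (1 <= n)%N ->
  ((pdeg h < pdeg g)%N /\ (1 <= pdeg h)%N \/ (1 <= pdeg g)%N /\ (pdeg g < pdeg h)%N) ->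
  Psi_ge g h n (d ^ n.-1).
Proof.
move=> n1 H.
have [[b ub]|[E E0 per]] := unreached_or_periodic g h d.
  apply: Psi_ge_le (unreached_bound cgh dgh d0 n1 ub).
  by rewrite leq_pexp2l // leq_pred.
rewrite -subn1.
have top (p q : {poly F}) : (pdeg p < pdeg q)%N -> maxn (size p) (size q) = d.+1 -> p`_d = 0.
  move=> pq m; have sp : (size p <= d)%N by move: pq m; rewrite /pdeg; lia.
  exact: nth_default.
have ntr : ~ tot_ram (pt F true).
  move/tot_ram_infty; rewrite Phi_infty /fib /=.
  case: H => -[H1 H2].
    have hd : h`_d = 0 by apply: (top h g) => //; rewrite maxnC.
    have gd : g`_d != 0.
      by have := regular_id cgh dgh (nz_pt F true); rewrite /nz Phi_infty /= hd eqxx orbF.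
    rewrite hd scale0r sub0r size_polyN size_scale // => sh.
    by move: H2; rewrite /pdeg; case: (size h) sh => [|[]].
  have gd : g`_d = 0 by apply: (top g h).
  have hd : h`_d != 0.
    by have := regular_id cgh dgh (nz_pt F true); rewrite /nz Phi_infty /= gd eqxx.
  rewrite gd scale0r subr0 size_scale // => sg.
  by move: H1; rewrite /pdeg; case: (size g) sg => [|[]].
have [b cb] : exists b, co b (Ph (pt F true)) = 0.
  rewrite Phi_infty; case: H => -[H1 H2].
    by exists true; apply: (top h g) => //; rewrite maxnC.
  by exists false; apply: (top g h).
exact: (not_tot_ram_bound cgh dgh d0 E0 per (x := pt F true) (t := 0) (b := b) (orb_pt _ _ _ _) ntr).
Qed.

Lemma equal_degree_case :
  (pdeg g = 0%N /\ (0 < pdeg h)%N \/ pdeg g = pdeg h) ->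
  (separable_rf g h \/ ~ is_L_of_frob g h) ->
  exists j : nat, forall n : nat, (1 <= n)%N ->
    ((n <= j)%N -> Psi_ge g h n (d ^ n)) /\
    ((j < n)%N -> Psi_ge g h n (d ^ (n - j))).
Proof.
move=> H nL.
have [[b ub]|[E E0 per]] := unreached_or_periodic g h d.
  exists 0%N => n n1; rewrite subn0; split=> _; exact: unreached_bound ub.
have [j [b [ret nb]]] := longest_return cgh dgh E0 per.
exists j => n n1; split=> jn.
  apply: (not_reached_bound cgh dgh d0 (b := b)) => // a s /andP [s0 sn].
  by apply: nb; rewrite s0 (leq_trans sn).
apply: (periodic_bound cgh dgh d0 E0 per) => // Htr.
have orb1 a : orb g h d (Ph (pt F a)) := orb_iter 1 (orb_pt g h d a).
(* The third point is f(0) when [g] is constant and f(oo) when the degrees are equal. *)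
suff [w [ow w1 w2]] : exists w, [/\ orb g h d w, w.1 != 0 & w.2 != 0].
  exact: some_not_tot_ram E0 per ow w1 w2 nL Htr.
case: H => [[sg _]|sgh].
  have sg1 : (size g <= 1)%N by move: sg; rewrite /pdeg; lia.
  have [g00 h00] := tot_ram_zero_image (Htr _ (orb_pt _ _ _ false)) (or_introl sg1).
  by exists (Ph (pt F false)); rewrite Phi_zero //; split=> //; rewrite -(Phi_zero dgh).
have [sg sh] : size g = d.+1 /\ size h = d.+1.
  by have := dgh; have := d2; move: sgh; rewrite /pdeg; lia.
exists (Ph (pt F true)); split=> //; rewrite Phi_infty /=.
  by have := lead_coef_eq0 g; rewrite lead_coefE sg /= => ->; rewrite -size_poly_eq0 sg.
by have := lead_coef_eq0 h; rewrite lead_coefE sh /= => ->; rewrite -size_poly_eq0 sh.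
Qed.
End Cases.

Theorem theorem1 (F : fieldType) (g h : {poly F}) :
  h != 0 -> coprimep g h ->
  let d := maxn (pdeg g) (pdeg h) in
  (2 <= d)%N ->
  ~ is_monomial g h ->
  ~ is_pbinomial g h ->
  ~ lin_conj g h 1 ('X ^+ d) ->
  (* (i) *)
  ((pdeg h = 0%N) ->
     forall n : nat, (1 <= n)%N ->
       ((forall k, (0 < k < n)%N -> ~ is_zero_of (fiter g h k) 0) ->
          Psi_ge g h n (d ^ n)) /\
       (forall e : nat, (0 < e < n)%N -> is_zero_of (fiter g h e) 0 ->
          (forall k, (0 < k < e)%N -> ~ is_zero_of (fiter g h k) 0) ->
          Psi_ge g h n (d ^ (n - e)))) /\
  (* (ii) *)
  (((pdeg h < pdeg g)%N /\ (1 <= pdeg h)%N \/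
    (1 <= pdeg g)%N /\ (pdeg g < pdeg h)%N) ->
     forall n : nat, (1 <= n)%N -> Psi_ge g h n (d ^ n.-1)) /\
  (* (iii) *)
  ((pdeg g = 0%N /\ (0 < pdeg h)%N \/ pdeg g = pdeg h) ->
   (separable_rf g h \/ ~ is_L_of_frob g h) ->
     exists j : nat, forall n : nat, (1 <= n)%N ->
       ((n <= j)%N -> Psi_ge g h n (d ^ n)) /\
       ((j < n)%N -> Psi_ge g h n (d ^ (n - j)))).
Proof.
move=> h0 cgh d d2 nmon nbin _.
have dgh : maxn (size g) (size h) = d.+1.
  by move: d2; rewrite /d /pdeg; lia.
split; [|split].
- move=> dh n n1; have sh : (size h <= 1)%N by move: dh; rewrite /pdeg; lia.
  have [H1 H2] := polynomial_case cgh dgh d2 h0 nmon sh nbin n1.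
  by split=> // e en ze _; apply: H2.
- by move=> H n n1; apply: unequal_degree_case.
- exact: equal_degree_case.
Qed.
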